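(* Let $\mathfrak{C}$ and $\mathfrak{D}$ be arbitrary classes of countable structures. Then $\mathfrak{C}$ is u.e.t. reducible to $\mathfrak{D}$ if and only if $\mathfrak{C}$ is u.c.t. reducible to $\mathfrak{D}$.
   Context: Structures: all structures are countable with universe $\omega$, in a relational language $(R_i)_{i\in\omega}$ where $R_i$ has arity $a_i$ and $i\mapsto a_i$ is computable. A class of structures (in a fixed language) is viewed as a category whose morphisms are the isomorphisms between its members; $Hom(\mathcal{A},\mathcal{B})$ is the set of isomorphisms from $\mathcal{A}$ to $\mathcal{B}$. Different classes may have different languages. A functor maps structures to structures and isomorphisms $f:\mathcal{A}\to\mathcal{B}$ to isomorphisms $F(f):F(\mathcal{A})\to F(\mathcal{B})$, preserving composition and identities. Coding: tuples of natural numbers are coded by numbers via a fixed computable coding $\langle\cdot\rangle$, and $\oplus$ and $\bigoplus_{i\in\omega}$ denote the usual effective joins of sets. $Graph(f)=\{\langle x,y\rangle: f(x)=y\}$. The atomic diagram of $\mathcal{A}$ is $D(\mathcal{A})=\bigoplus_{i\in\omega}R_i^{\mathcal{A}}\oplus\bigoplus_{i\in\omega}\neg R_i^{\mathcal{A}}$. An enumeration operator $\Psi$ is a c.e. set of pairs $(E,x)$ with $E$ (a code of) a finite set, and $\Psi^X=\{x:\exists E\subseteq X\ (E,x)\in\Psi\}$. For a Turing operator $\Phi$ and a set $Y$, $\Phi^X=Y$ means that $\Phi$ computes the characteristic function of $Y$ from the oracle $X$; for a function $g$, $\Phi^X=g$ means $\Phi$ computes $g$ from $X$. A functor $F:\mathfrak{C}\to\mathfrak{D}$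 is computable if there are Turing operators $\Phi,\Phi_*$ such that for all $\mathcal{A},\mathcal{B}\in\mathfrak{C}$: (1) $\Phi^{D(\mathcal{A})}=D(F(\mathcal{A}))$; (2) for all $f\in Hom(\mathcal{A},\mathcal{B})$, $\Phi_*^{D(\mathcal{A})\oplus Graph(f)\oplus D(\mathcal{B})}=F(f)$. It is enumerable if there are enumeration operators $\Psi,\Psi_*$ such that for all $\mathcal{A},\mathcal{B}\in\mathfrak{C}$: (1) $\Psi^{D(\mathcal{A})}=D(F(\mathcal{A}))$; (2) for all $f\in Hom(\mathcal{A},\mathcal{B})$, $\Psi_*^{D(\mathcal{A})\oplus Graph(f)\oplus D(\mathcal{B})}=Graph(F(f))$. A functor $F:\mathfrak{C}\to\mathfrak{D}$ is effectively isomorphic to $G:\mathfrak{C}\to\mathfrak{D}$ via a Turing functional $\Lambda$ if for every $\mathcal{A}\in\mathfrak{C}$, $\Lambda^{\mathcal{A}}$ (computed with oracle $D(\mathcal{A})$) is an isomorphism $F(\mathcal{A})\to G(\mathcal{A})$, and for every $h\in Hom(\mathcal{A},\mathcal{B})$ in $\mathfrak{C}$, $\Lambda^{\mathcal{B}}\circ F(h)=G(h)\circ\Lambda^{\mathcal{A}}$. Functors $F:\mathfrak{C}\to\mathfrak{D}$, $G:\mathfrak{D}\to\mathfrak{C}$ are pseudo inverses if there are Turing functionals $\Lambda_{\mathfrak{C}},\Lambda_{\mathfrak{D}}$ such that $Id_{\mathfrak{C}}$ is effectively isomorphic to $G\circ F$ via $\Lambda_{\mathfrak{C}}$, $Id_{\mathfrak{D}}$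 is effectively isomorphic to $F\circ G$ via $\Lambda_{\mathfrak{D}}$, and for all $\mathcal{A}\in\mathfrak{C}$, $\mathcal{B}\in\mathfrak{D}$: $\Lambda_{\mathfrak{D}}^{F(\mathcal{A})}=F(\Lambda_{\mathfrak{C}}^{\mathcal{A}}):F(\mathcal{A})\to F(G(F(\mathcal{A})))$ and $\Lambda_{\mathfrak{C}}^{G(\mathcal{B})}=G(\Lambda_{\mathfrak{D}}^{\mathcal{B}}):G(\mathcal{B})\to G(F(G(\mathcal{B})))$. A class $\mathfrak{C}$ is uniformly computably transformably reducible (u.c.t. reducible), respectively uniformly enumerably transformably reducible (u.e.t. reducible), to $\mathfrak{D}$ if there are a subclass $\mathfrak{D}'\subseteq\mathfrak{D}$ and computable, respectively enumerable, functors $F:\mathfrak{C}\to\mathfrak{D}'$ and $G:\mathfrak{D}'\to\mathfrak{C}$ that are pseudo inverses. *)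

(* Defs.v *)
From mathcomp Require Import all_boot.
From mathcomp Require Import boolp classical_sets.

Set Implicit Arguments.
Unset Strict Implicit.
Unset Printing Implicit Defensive.

Local Open Scope classical_set_scope.

(* Programs for the n-ary partial recursive functions relative to an oracle.
   The inner programs of a composition are a family indexed by the finite type
   'I_m, so every program is a finite object. *)
Inductive prog : nat -> Type :=
| PZero n : prog n
| PSucc : prog 1
| PProj n (i : 'I_n) : prog n
| POracle : prog 1
| PComp m n (f : prog m) (g : 'I_m -> prog n) : prog n
| PRec n (f : prog n) (g : prog n.+2) : prog n.+1
| PMu n (f : prog n.+1) : prog n.

Fixpoint prim_rec (base : nat -> Prop) (step : nat -> nat -> nat -> Prop)
    (k r : nat) : Prop :=
  if k is k'.+1 then exists s, prim_rec base step k' s /\ step k' s r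
  else base r.

(* [eval X p v r]: with oracle X, the program p halts on input v with value r.
   Recursion and minimization act on the first argument; [PMu] requires all
   values below the least zero to be defined. *)
Fixpoint eval (X : set nat) n (p : prog n) : n.-tuple nat -> nat -> Prop :=
  match p in prog n return n.-tuple nat -> nat -> Prop with
  | PZero _ => fun _ r => r = 0
  | PSucc => fun v r => r = (thead v).+1
  | PProj _ i => fun v r => r = tnth v i
  | POracle => fun v r =>
      (X (thead v) /\ r = 1) \/ (~ X (thead v) /\ r = 0)
  | PComp m _ f g => fun v r =>
      exists w : m.-tuple nat,
        (forall i, eval X (g i) v (tnth w i)) /\ eval X f w r
  | PRec _ f g => fun v r =>
      prim_rec (eval X f [tuple of behead v])
        (fun k s => eval X g [tuple of k :: s :: behead v]) (thead v) r
  | PMu _ f => fun v r =>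
      eval X f [tuple of r :: v] 0 /\
      forall k, k < r -> exists s, eval X f [tuple of k :: v] s.+1
  end.

Lemma eval_functional X n (p : prog n) v r r' :
  eval X p v r -> eval X p v r' -> r = r'.
Proof.
elim: p v r r' => {n} /= [n|  |n i| |m n f IHf g IHg|n f IHf g IHg|n f IHf] v r r'.
- by move=> -> ->.
- by move=> -> ->.
- by move=> -> ->.
- by move=> [[? ->]|[? ->]] [[? ->]|[? ->]].
- move=> [w [gw fw]] [w' [gw' fw']].
  have ww' : w = w' by apply: eq_from_tnth => i; apply: IHg (gw i) (gw' i).
  by move: fw'; rewrite -ww'; apply: IHf fw.
- elim: (thead v) r r' => /= [|k IHk] r r'; first exact: IHf.
  move=> [s [ks gr]] [s' [ks' gr']].
  by move: gr'; rewrite -(IHk _ _ ks ks'); apply: IHg gr.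
- move=> [fr rmin] [fr' rmin']; case: (ltngtP r r') => // lt_rr'.
  + by case: (rmin' _ lt_rr') => s /(IHf _ _ _ fr).
  + by case: (rmin _ lt_rr') => s /(IHf _ _ _ fr').
Qed.

Definition turing_op := prog 1.

(* Phi^X = g for a function g *)
Definition computes_fun (Phi : turing_op) (X : set nat) (g : nat -> nat) :=
  forall n, eval X Phi [tuple n] (g n).

(* Phi^X = Y for a set Y *)
Definition computes_set (Phi : turing_op) (X Y : set nat) :=
  forall n, (Y n -> eval X Phi [tuple n] 1) /\ (~ Y n -> eval X Phi [tuple n] 0).

Definition computable (g : nat -> nat) := exists p, computes_fun p set0 g.

Definition ce (W : set nat) :=
  exists p : prog 1, W = [set n | exists r, eval set0 p [tuple n] r].

Definition join (X Y : set nat) : set nat :=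
  [set x.*2 | x in X] `|` [set x.*2.+1 | x in Y].

Definition bigjoin (X : nat -> set nat) : set nat :=
  [set n | exists i x, X i x /\ n = CodeSeq.code [:: i; x]].

Definition graph (f : nat -> nat) : set nat :=
  [set CodeSeq.code [:: x; f x] | x in setT].

(* The finite set with canonical index e: the positions of the binary digits 1
   of e. *)
Definition fin_set (e : nat) : set nat := [set x | odd (e %/ 2 ^ x)].

Record enum_op := EnumOp { enum_set : set nat; enum_ce : ce enum_set }.

Definition enum_app (Psi : enum_op) (X : set nat) : set nat :=
  [set x | exists e, fin_set e `<=` X /\ enum_set Psi (CodeSeq.code [:: e; x])].

Record language :=
  Language { arity :> nat -> nat; arity_computable : computable arity }.

Definition structure (L : language) := forall i, set ((L i).-tuple nat).

Definition diagram (L : language) (A : structure L) : set nat :=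
  join (bigjoin (fun i => [set CodeSeq.code (tval t) | t in A i]))
       (bigjoin (fun i => [set CodeSeq.code (tval t) | t in ~` A i])).

Record iso (L : language) (A B : structure L) := Iso {
  iso_fun :> nat -> nat;
  iso_bij : bijective iso_fun;
  iso_rel : forall i (t : (L i).-tuple nat),
    A i t <-> B i [tuple of map iso_fun t] }.

Lemma iso_id_rel (L : language) (A : structure L) i (t : (L i).-tuple nat) :
  A i t <-> A i [tuple of map id t].
Proof.
by have -> : [tuple of map id t] = t by apply: val_inj; rewrite /= map_id.
Qed.

Definition iso_id (L : language) (A : structure L) : iso A A :=
  Iso (Bijective (fun _ => erefl) (fun _ => erefl)) (@iso_id_rel L A).

Lemma iso_comp_rel (L : language) (A B E : structure L)
    (g : iso B E) (f : iso A B) i (t : (L i).-tuple nat) :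
  A i t <-> E i [tuple of map (g \o f) t].
Proof.
have -> : [tuple of map (g \o f) t] = [tuple of map g [tuple of map f t]].
  by apply: val_inj; rewrite /= map_comp.
by split=> [/(iso_rel f)/(iso_rel g)|/(iso_rel g)/(iso_rel f)].
Qed.

Definition iso_comp (L : language) (A B E : structure L)
    (g : iso B E) (f : iso A B) : iso A E :=
  Iso (bij_comp (iso_bij g) (iso_bij f)) (iso_comp_rel g f).

Definition class (L : language) := set (structure L).

Definition obj (L : language) (C : class L) := {A : structure L | C A}.

Definition str (L : language) (C : class L) (A : obj C) : structure L :=
  proj1_sig A.
Coercion str : obj >-> structure.

Record functor (L1 L2 : language) (C : class L1) (D : class L2) := Functor {
  fobj :> obj C -> obj D;
  fmap : forall A B : obj C, iso A B -> iso (fobj A) (fobj B);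
  fmap_id : forall A : obj C, fmap (iso_id A) =1 id;
  fmap_comp : forall (A B E : obj C) (g : iso B E) (f : iso A B),
    fmap (iso_comp g f) =1 fmap g \o fmap f }.

Definition functor_id (L : language) (C : class L) : functor C C :=
  @Functor L L C C id (fun A B f => f) (fun _ _ => erefl)
    (fun _ _ _ _ _ _ => erefl).

Section FunctorComp.
Variables (L1 L2 L3 : language).
Variables (C : class L1) (D : class L2) (E : class L3).
Variables (G : functor D E) (F : functor C D).

(* The functor laws only speak of underlying functions; by function
   extensionality and proof irrelevance, these determine isomorphisms. *)
Lemma iso_ext (L : language) (A B : structure L) (f g : iso A B) :
  f =1 g -> f = g.
Proof.
case: f g => [f bf rf] [g bg rg] /= /funext fg; case: _ / fg bg rg => bg rg.
by congr Iso; apply: Prop_irrelevance.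
Qed.

Definition comp_fmap (A B : obj C) (f : iso A B) := fmap G (fmap F f).

Lemma comp_fmap_id (A : obj C) : comp_fmap (iso_id A) =1 id.
Proof.
have -> : comp_fmap (iso_id A) = fmap G (iso_id (F A)).
  by congr fmap; apply: iso_ext; apply: fmap_id.
exact: fmap_id.
Qed.

Lemma comp_fmap_comp (A B H : obj C) (g : iso B H) (f : iso A B) :
  comp_fmap (iso_comp g f) =1 comp_fmap g \o comp_fmap f.
Proof.
have -> : comp_fmap (iso_comp g f) = fmap G (iso_comp (fmap F g) (fmap F f)).
  by congr fmap; apply: iso_ext; apply: fmap_comp.
exact: fmap_comp.
Qed.

Definition functor_comp : functor C E := Functor comp_fmap_id comp_fmap_comp.

End FunctorComp.

Definition computable_functor (L1 L2 : language) (C : class L1) (D : class L2)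
    (F : functor C D) :=
  exists Phi Phis : turing_op,
    (forall A : obj C, computes_set Phi (diagram A) (diagram (F A))) /\
    (forall (A B : obj C) (f : iso A B),
       computes_fun Phis (join (join (diagram A) (graph f)) (diagram B))
         (fmap F f)).

Definition enumerable_functor (L1 L2 : language) (C : class L1) (D : class L2)
    (F : functor C D) :=
  exists Psi Psis : enum_op,
    (forall A : obj C, enum_app Psi (diagram A) = diagram (F A)) /\
    (forall (A B : obj C) (f : iso A B),
       enum_app Psis (join (join (diagram A) (graph f)) (diagram B)) =
         graph (fmap F f)).

Record eff_iso (L1 L2 : language) (C : class L1) (D : class L2)
    (F G : functor C D) := EffIso {
  eff_op : turing_op;
  eff_at :> forall A : obj C, iso (F A) (G A);
  eff_computes : forall A : obj C, computes_fun eff_op (diagram A) (eff_at A);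
  eff_natural : forall (A B : obj C) (h : iso A B),
    eff_at B \o fmap F h =1 fmap G h \o eff_at A }.

Definition pseudo_inverses (L1 L2 : language) (C : class L1) (D : class L2)
    (F : functor C D) (G : functor D C) :=
  exists (LC : eff_iso (functor_id C) (functor_comp G F))
         (LD : eff_iso (functor_id D) (functor_comp F G)),
    (forall A : obj C, LD (F A) =1 fmap F (LC A)) /\
    (forall B : obj D, LC (G B) =1 fmap G (LD B)).

Definition uct_reducible (L1 L2 : language) (C : class L1) (D : class L2) :=
  exists D' : class L2, D' `<=` D /\
  exists (F : functor C D') (G : functor D' C),
    [/\ computable_functor F, computable_functor G & pseudo_inverses F G].

Definition uet_reducible (L1 L2 : language) (C : class L1) (D : class L2) :=
  exists D' : class L2, D' `<=` D /\
  exists (F : functor C D') (G : functor D' C),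
    [/\ enumerable_functor F, enumerable_functor G & pseudo_inverses F G].

(* Main.v *)
From mathcomp Require Import all_boot.
From mathcomp Require Import boolp classical_sets.
Require Import Defs.

Set Implicit Arguments.
Unset Strict Implicit.
Unset Printing Implicit Defensive.

Local Open Scope classical_set_scope.

(** The difference between the two reducibilities is that computations may use
    negative information on their oracles and have to decide their outputs,
    while enumeration operators neither see negative information nor produce it.
    The difference disappears because, for every set that serves as an oracle or
    as an output here, the complement can be enumerated from the set itself. In
    an atomic diagram, a number that is not listed either is not an atomic
    statement, which is decidable since arities are computable, or is the negation
    of a listed one; in the graph of a function, a missing pair is refuted by the
    pair that is present; and the property passes to joins. It is called
    [co_query] below, and is established in [diagram_co_query],
    [graph_co_query] and [join_co_query].

    Given this, a functor is enumerable iff it is computable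
    ([enumerable_iff_computable]), and the theorem follows with the same subclass,
    functors and pseudo inverses.

    From enumerable to computable: to decide [n], wait until [n] is enumerated
    or until its complement is confirmed ([decision_of_enum]); to compute a value
    of a function, wait for its pair in the graph ([function_of_enum]).

    From computable to enumerable: a halting computation uses finitely many
    oracle answers, and both kinds of answers can be drawn from a finite part of
    the oracle. So the operator consists of the pairs of a finite set and a number
    such that the simulation of the computation from that finite set accepts the
    number ([enum_of_computation]).

    Both directions rest on one simulation of programs, [run], which takes a
    partial oracle and a bound on searches, and is itself computable
    ([ucomp_run]), correct ([run_sound]) and, along directed families of
    oracles and bounds, complete ([run_complete]). *)

(** * Total functions computable uniformly in the oracle *)

(** Inputs are read off an infinite sequence, so that functions of any number of
    variables share one type, variables are [w 0], [w 1], and so on, and binding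
    a variable shifts indices up to conversion. *)
Definition tup n (w : nat -> nat) : n.-tuple nat := [tuple w i | i < n].

Definition scons (k : nat) (w : nat -> nat) (i : nat) : nat :=
  if i is j.+1 then w j else k.

Definition shift (w : nat -> nat) (i : nat) : nat := w i.+1.

Lemma tnth_tup n w i : tnth (tup n w) i = w i.
Proof. exact: tnth_mktuple. Qed.

Lemma thead_tup n w : thead (tup n.+1 w) = w 0.
Proof. by rewrite /thead tnth_tup. Qed.

Lemma behead_tup n w : [tuple of behead (tup n.+1 w)] = tup n (shift w).
Proof.
apply: eq_from_tnth => i.
by rewrite tnth_behead !tnth_tup inordK // ltnS.
Qed.

Lemma cons_tup n k w : [tuple of k :: tup n w] = tup n.+1 (scons k w).
Proof.
apply: eq_from_tnth => i; rewrite tnth_tup.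
case: (unliftP ord0 i) => [j|] ->; last exact: tnth0.
by rewrite tnthS tnth_tup.
Qed.

Lemma rec_tup n k r w :
  [tuple of k :: r :: behead (tup n.+1 w)] = tup n.+2 (scons k (scons r (shift w))).
Proof. by rewrite -!cons_tup -behead_tup; apply: val_inj. Qed.

Lemma tupE n (v : n.-tuple nat) : v = tup n (nth 0 v).
Proof. by apply: eq_from_tnth => i; rewrite tnth_tup (tnth_nth 0). Qed.

Lemma tup1 n : [tuple n] = tup 1 (fun=> n).
Proof. by apply: eq_from_tnth => i; rewrite tnth_tup !ord1. Qed.

(** Uniformity in the oracle: one program works for all [X]. Predicates are
    treated as functions with values in [bool], coerced to 0 and 1. *)
Definition ucomp n (f : set nat -> (nat -> nat) -> nat) :=
  exists p : prog n, forall X w, eval X p (tup n w) (f X w).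

Section Closure.
Variable n : nat.
Implicit Types a b c : set nat -> (nat -> nat) -> nat.

Lemma ucomp_ext a b : (forall X w, a X w = b X w) -> ucomp n a -> ucomp n b.
Proof. by move=> eab [p pP]; exists p => X w; rewrite -eab. Qed.

Lemma ucomp_var i : i < n -> ucomp n (fun _ w => w i).
Proof.
by move=> lt_in; exists (PProj (Ordinal lt_in)) => X w /=; rewrite tnth_tup.
Qed.

Lemma ucomp_subst m f (g : nat -> set nat -> (nat -> nat) -> nat) :
  ucomp m f -> (forall i, i < m -> ucomp n (g i)) ->
  ucomp n (fun X w => f X (fun i => g i X w)).
Proof.
move=> [p pP] gP; have {}gP (i : 'I_m) : ucomp n (g i) by apply: gP.
have [q qP] := choice gP; exists (PComp p q) => X w /=.
exists (tup m (fun i => g i X w)); split=> [i|]; last exact: pP.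
by rewrite tnth_tup.
Qed.

Lemma ucomp_succ a : ucomp n a -> ucomp n (fun X w => (a X w).+1).
Proof.
move=> aP; apply: (@ucomp_subst 1 (fun _ w => (w 0).+1) (fun=> a)) => //.
by exists PSucc => X w /=; rewrite thead_tup.
Qed.

Lemma ucomp_const k : ucomp n (fun _ _ => k).
Proof. by elim: k => [|k]; [exists (PZero n) | apply: ucomp_succ]. Qed.

Lemma ucomp_oracle a : ucomp n a -> ucomp n (fun X w => `[< X (a X w) >]).
Proof.
move=> aP.
apply: (@ucomp_subst 1 (fun X w => `[< X (w 0) >]) (fun=> a)) => //.
by exists POracle => X w /=; rewrite thead_tup; case: asboolP; [left|right].
Qed.

End Closure.

(** In the context of [st] the counter is variable 0, the accumulator is
    variable 1, and the outer variables are shifted by 2. *)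
Lemma ucomp_rec n b (st : set nat -> nat -> nat -> (nat -> nat) -> nat) c :
  ucomp n b -> ucomp n.+2 (fun X w => st X (w 0) (w 1) (fun i => w i.+2)) ->
  ucomp n c ->
  ucomp n (fun X w => nat_rect (fun=> nat) (b X w)
                        (fun k acc => st X k acc w) (c X w)).
Proof.
move=> [pb pbP] [ps psP] cP.
pose f X (w : nat -> nat) := nat_rect (fun=> nat) (b X (shift w))
  (fun k acc => st X k acc (shift w)) (w 0).
apply: (@ucomp_subst n n.+1 f (fun i => if i is j.+1 then fun _ w => w j else c)).
  exists (PRec pb ps) => X w; rewrite /= /f thead_tup behead_tup.
  elim: (w 0) => [|k IHk] /=; first exact: pbP.
  eexists; split; first exact: IHk.
  set acc := nat_rect _ _ _ k.
  have := psP X (scons k (scons acc (shift w))).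
  by rewrite -rec_tup.
by move=> [//|i]; rewrite ltnS; apply: ucomp_var.
Qed.

Lemma ucomp_pred n a : ucomp n a -> ucomp n (fun X w => (a X w).-1).
Proof.
move=> aP; have := ucomp_rec (st := fun _ k _ _ => k) (ucomp_const n 0)
  (ucomp_var (ltn0Sn n.+1)) aP.
by apply: ucomp_ext => X w /=; case: (a X w).
Qed.

Lemma ucomp_add n a b :
  ucomp n a -> ucomp n b -> ucomp n (fun X w => a X w + b X w).
Proof.
move=> aP bP.
have := ucomp_rec (st := fun _ _ r _ => r.+1) aP
  (ucomp_succ (@ucomp_var n.+2 1 isT)) bP.
by apply: ucomp_ext => X w /=; elim: (b X w) => [|k /= ->]; rewrite ?addn0 ?addnS.
Qed.

Lemma ucomp_sub n a b :
  ucomp n a -> ucomp n b -> ucomp n (fun X w => a X w - b X w).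
Proof.
move=> aP bP.
have sP := ucomp_pred (@ucomp_var n.+2 1 isT).
have := ucomp_rec (st := fun _ _ r _ => r.-1) aP sP bP.
by apply: ucomp_ext => X w /=; elim: (b X w) => [|k /= ->]; rewrite ?subn0 ?subnS.
Qed.

Lemma ucomp_sum n (F : set nat -> (nat -> nat) -> nat -> nat) b :
  ucomp n.+1 (fun X w => F X (fun i => w i.+1) (w 0)) -> ucomp n b ->
  ucomp n (fun X w => \sum_(0 <= k < b X w) F X w k).
Proof.
move=> FP bP.
have sP : ucomp n.+2 (fun X w => w 1 + F X (fun i => w i.+2) (w 0)).
  apply: ucomp_add; first exact: ucomp_var.
  apply: (ucomp_subst (g := fun i => if i is j.+1 then fun _ w => w j.+2
    else fun _ w => w 0) FP) => -[|i] lt_i; exact: ucomp_var.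
have := ucomp_rec (st := fun X k r w => r + F X w k) (ucomp_const n 0) sP bP.
apply: ucomp_ext => X w /=.
by elim: (b X w) => [|k /= ->]; rewrite ?big_nil // big_nat_recr.
Qed.

Section Logic.
Variable n : nat.
Implicit Types a b c : set nat -> (nat -> nat) -> nat.
Implicit Types P Q : set nat -> (nat -> nat) -> bool.

Lemma ucomp_mul a b :
  ucomp n a -> ucomp n b -> ucomp n (fun X w => a X w * b X w).
Proof.
move=> aP bP.
have cP : ucomp n.+1 (fun X w => a X (fun i => w i.+1)).
  by apply: (ucomp_subst (g := fun i _ w => w i.+1) aP) => i lt_i; apply: ucomp_var.
have := ucomp_sum (F := fun X w _ => a X w) cP bP.
by apply: ucomp_ext => X w; rewrite sum_nat_const_nat subn0 mulnC.
Qed.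

Lemma ucomp_exp2 a : ucomp n a -> ucomp n (fun X w => 2 ^ a X w).
Proof.
move=> aP; have v1 := @ucomp_var n.+2 1 isT.
have := ucomp_rec (st := fun _ _ r _ => r + r) (ucomp_const n 1) (ucomp_add v1 v1) aP.
apply: ucomp_ext => X w /=.
by elim: (a X w) => [|k /= ->] //; rewrite addnn -mul2n expnS.
Qed.

Lemma ucomp_not P : ucomp n P -> ucomp n (fun X w => ~~ P X w).
Proof.
move=> PP; apply: ucomp_ext (ucomp_sub (ucomp_const n 1) PP) => X w.
by case: (P X w).
Qed.

Lemma ucomp_and P Q : ucomp n P -> ucomp n Q -> ucomp n (fun X w => P X w && Q X w).
Proof.
by move=> PP QP; apply: ucomp_ext (ucomp_mul PP QP) => X w; rewrite mulnb.
Qed.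

Lemma ucomp_or P Q : ucomp n P -> ucomp n Q -> ucomp n (fun X w => P X w || Q X w).
Proof.
move=> PP QP.
apply: ucomp_ext (ucomp_not (ucomp_and (ucomp_not PP) (ucomp_not QP))) => X w.
by rewrite negb_and !negbK.
Qed.

Lemma ucomp_leq a b : ucomp n a -> ucomp n b -> ucomp n (fun X w => a X w <= b X w).
Proof.
move=> aP bP.
apply: ucomp_ext (ucomp_sub (ucomp_const n 1) (ucomp_sub aP bP)) => X w.
by rewrite -[in RHS]subn_eq0; case: (a X w - b X w) => [|[]].
Qed.

Lemma ucomp_eq a b : ucomp n a -> ucomp n b -> ucomp n (fun X w => a X w == b X w).
Proof.
move=> aP bP; apply: ucomp_ext (ucomp_and (ucomp_leq aP bP) (ucomp_leq bP aP)) => X w.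
by rewrite eqn_leq.
Qed.

Lemma ucomp_if P a b : ucomp n P -> ucomp n a -> ucomp n b ->
  ucomp n (fun X w => if P X w then a X w else b X w).
Proof.
move=> PP aP bP.
apply: ucomp_ext (ucomp_add (ucomp_mul PP aP) (ucomp_mul (ucomp_not PP) bP)) => X w.
by case: (P X w); rewrite ?mul1n ?mul0n ?addn0.
Qed.

End Logic.

Section BoundedQuantifiers.
Variable n : nat.
Implicit Types b : set nat -> (nat -> nat) -> nat.

Lemma ucomp_has (P : set nat -> (nat -> nat) -> nat -> bool) b :
  ucomp n.+1 (fun X w => P X (fun i => w i.+1) (w 0)) -> ucomp n b ->
  ucomp n (fun X w => has (P X w) (iota 0 (b X w))).
Proof.
move=> PP bP.
have := ucomp_leq (ucomp_const n 1) (ucomp_sum (F := fun X w k => P X w k) PP bP).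
apply: ucomp_ext => X w; rewrite has_count -sum1_count [in RHS]big_mkcond.
by rewrite /index_iota subn0; congr (nat_of_bool (leq 1 _)).
Qed.

Lemma ucomp_all (P : set nat -> (nat -> nat) -> nat -> bool) b :
  ucomp n.+1 (fun X w => P X (fun i => w i.+1) (w 0)) -> ucomp n b ->
  ucomp n (fun X w => all (P X w) (iota 0 (b X w))).
Proof.
move=> PP bP.
apply: ucomp_ext (ucomp_not (ucomp_has (P := fun X w k => ~~ P X w k) (ucomp_not PP) bP)) => X w.
by rewrite has_predC negbK.
Qed.

Lemma ucomp_all_seq (I : Type) (P : set nat -> (nat -> nat) -> I -> bool) (l : seq I) :
  (forall i, ucomp n (fun X w => P X w i)) -> ucomp n (fun X w => all (P X w) l).
Proof.
move=> PP; elim: l => [|i l IHl] /=; first exact: ucomp_const.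
exact: ucomp_and.
Qed.

End BoundedQuantifiers.

(** * Search, and bounded simulation of programs *)

(** Unbounded search for a [z] with [P], followed by [h]. By the second clause
    the program diverges when there is no such [z], so that its domain is the set
    of inputs with a witness. *)
Lemma search_program n (P : set nat -> (nat -> nat) -> bool) h :
  ucomp n.+1 P -> ucomp n.+1 h ->
  exists p : prog n, forall X w,
    ((exists z, P X (scons z w)) ->
       exists z, P X (scons z w) /\ eval X p (tup n w) (h X (scons z w))) /\
    (forall r, eval X p (tup n w) r -> exists z, P X (scons z w)).
Proof.
move=> PP [ph phP]; have [pP pPP] := ucomp_not PP.
(* The first argument of [h] is the least zero of the negation of [P]. *)
exists (PComp ph (fun i => if unlift ord0 i is Some j then PProj j else PMu pP)).
move=> X w.
have pPE z b : eval X pP [tuple of z :: tup n w] b <-> b = ~~ P X (scons z w).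
  rewrite cons_tup; split=> [/eval_functional /(_ (pPP _ _)) //|->]; exact: pPP.
split=> [exP|r /= [v [vP _]]]; last first.
  exists (tnth v ord0); have := vP ord0; rewrite unlift_none => -[/pPE].
  by case: (P X _).
have exz := exP; case: (ex_minnP exP) => z Pz z_min.
exists z; split=> //=; exists (tup n.+1 (scons z w)); split; last exact: phP.
move=> i; case: (unliftP ord0 i) => [j|] ->; rewrite /= !tnth_tup //.
split=> [|k lt_kz]; first by apply/pPE; rewrite Pz.
exists 0; apply/pPE; case Pk: (P X _) => //.
by move: lt_kz; rewrite ltnNge z_min.
Qed.

(** The number [t] computed by the loop is a state: 0 while no zero has been
    met, 1 once an undefined value has been met, [z.+2] once the first zero,
    at [z], has been found. Its predecessor is thus in the format of [run]. *)
Definition search_loop (F : nat -> nat) (s : nat) : nat :=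
  (nat_rect (fun=> nat) 0
    (fun k t => if t == 0 then
       let y := F k in if y == 0 then 1 else if y == 1 then k.+2 else 0
     else t) s).-1.

Lemma search_loopP (F : nat -> nat) s r :
  search_loop F s = r.+1 <->
  [/\ r < s, F r = 1 & forall k, k < r -> 1 < F k].
Proof.
rewrite /search_loop; set L := nat_rect _ _ _.
have L0 t : L t = 0 <-> forall k, k < t -> 1 < F k.
  elim: t => [|t IHt]; first by split.
  rewrite /=; split.
    case: (L t) IHt => // IHt; case Ft: (F t) => [|[|y]] //= _ k.
    by rewrite ltnS leq_eqVlt => /orP [/eqP ->|]; [rewrite Ft | apply: IHt.1].
  move=> Fgt; rewrite IHt.2 => [/=|k lt_kt]; last by apply: Fgt; apply: ltnW.
  by have := Fgt t (leqnn _); case: (F t) => [|[|]].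
elim: s => [|s IHs]; first by split=> // -[].
rewrite [L _]/=; case Ls: (L s) => [|l] /=.
  have Fgt := (L0 s).1 Ls; case Fs: (F s) => [|[|y]] /=.
  - split=> // -[lt_rs Fr _]; move: Fr; move: lt_rs.
    by rewrite ltnS leq_eqVlt => /orP [/eqP ->|/Fgt]; [rewrite Fs | case: (F r) => [|[]]].
  - split=> [[<-]|[lt_rs Fr _]]; first by split.
    by move: lt_rs; rewrite ltnS leq_eqVlt => /orP [/eqP ->|/Fgt] //; rewrite Fr.
  - split=> // -[lt_rs Fr _]; move: Fr; move: lt_rs.
    by rewrite ltnS leq_eqVlt => /orP [/eqP ->|/Fgt]; [rewrite Fs | case: (F r) => [|[]]].
move: IHs; rewrite Ls /= => ->; split=> -[lt_rs Fr Fk]; split=> //.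
  exact: ltnW.
rewrite ltn_neqAle -ltnS lt_rs andbT; apply/eqP => r_s.
by move: Fk; rewrite r_s => /L0; rewrite Ls.
Qed.

(** Evaluation of [p] with all searches cut at [s] and with the partial oracle
    [o]; 0 stands for undefined and [r.+1] for the result [r]. It is total, and
    serves both as a step-bounded simulation of a program (with a total oracle)
    and as a simulation from finite information on an oracle. *)
Fixpoint run (o : nat -> nat) (s : nat) n (p : prog n) (w : nat -> nat) : nat :=
  match p with
  | PZero _ => 1
  | PSucc => (w 0).+2
  | PProj _ i => (w i).+1
  | POracle => o (w 0)
  | PComp m _ f g =>
      if all (fun i : 'I_m => run o s (g i) w != 0) (enum 'I_m)
      then run o s f (fun j => if insub j is Some i then (run o s (g i) w).-1 else 0)
      else 0
  | PRec _ f g =>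
      nat_rect (fun=> nat) (run o s f (shift w))
        (fun k r => if r == 0 then 0 else run o s g (scons k (scons r.-1 (shift w))))
        (w 0)
  | PMu _ f => search_loop (fun k => run o s f (scons k w)) s
  end.

(** In the format of [run]: the answers that [o] gives are those of [X]. *)
Definition approximates (X : set nat) (o : nat -> nat) :=
  forall a b, o a = b.+1 -> b = `[< X a >].

Lemma run_sound X o s n (p : prog n) w r :
  approximates X o -> run o s p w = r.+1 -> eval X p (tup n w) r.
Proof.
move=> oX; elim: p w r => {n} /= [n|  |n i| |m n f IHf g IHg|n f IHf g IHg|n f IHf] w r.
- by case.
- by rewrite thead_tup => -[].
- by rewrite tnth_tup => -[].
- by rewrite thead_tup => /oX ->; case: asboolP; [left|right].
- case: ifP => // /allP gP /IHf fP; eexists; split; last exact: fP.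
  move=> i; apply: IHg; rewrite tnth_tup valK prednK // lt0n.
  by apply: gP; rewrite mem_enum.
- rewrite thead_tup behead_tup.
  elim: (w 0) r => [|k IHk] r /=; first exact: IHf.
  set q := nat_rect _ _ _ k in IHk *; case Eq: q => [|y] //= /IHg gP.
  by exists y; split; [exact: IHk | rewrite rec_tup].
- move=> /search_loopP [_ fr rmin]; rewrite cons_tup; split; first exact: IHf.
  move=> k /rmin; case fk: (run _ _ _ _) => [|[|y]] // _.
  by exists y; rewrite cons_tup; apply: IHf.
Qed.

Definition oracle_le (o o' : nat -> nat) := forall a b, o a = b.+1 -> o' a = b.+1.

Lemma run_mono o o' s s' n (p : prog n) w r :
  oracle_le o o' -> s <= s' -> run o s p w = r.+1 -> run o' s' p w = r.+1.
Proof.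
move=> oo' ss'.
elim: p w r => {n} /= [n|  |n i| |m n f IHf g IHg|n f IHf g IHg|n f IHf] w r //.
- exact: oo'.
- case: ifP => // /allP gP fP.
  have gE i : run o' s' (g i) w = run o s (g i) w.
    have := gP i; rewrite mem_enum => /(_ isT).
    by case Eg: (run o s (g i) w) => [|y] // _; apply: IHg.
  rewrite (eq_all (a2 := fun i => run o s (g i) w != 0)) => [|i]; last by rewrite gE.
  case: allP => [_|]; last by case.
  apply: IHf; rewrite -fP; congr run.
  by apply/funext => j; case: insub => // i; rewrite gE.
- elim: (w 0) r => [|k IHk] r /=; first exact: IHf.
  set q := nat_rect _ _ _ k in IHk *; case Eq: q => [|y] //= /IHg gP.
  by rewrite (IHk _ Eq).
- move=> /search_loopP [lt_rs fr rmin]; apply/search_loopP; split.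
  + exact: leq_trans ss'.
  + exact: IHf.
  + move=> k /rmin; case fk: (run _ _ _ _) => [|[|y]] // _.
    by rewrite (IHf _ _ fk).
Qed.

Section Completeness.
Variables (X : set nat) (J : Type) (o : J -> nat -> nat) (s : J -> nat).
Hypothesis o_directed : forall i j, exists k,
  [/\ oracle_le (o i) (o k), oracle_le (o j) (o k), s i <= s k & s j <= s k].
Hypothesis s_unbounded : forall N, exists j, N <= s j.
Hypothesis o_exhaustive : forall a, exists j, o j a = (`[< X a >] : nat).+1.

Let upward (Q : J -> Prop) := forall i j, oracle_le (o i) (o j) -> s i <= s j -> Q i -> Q j.

Lemma bounded_choice (Q : nat -> J -> Prop) m :
  (forall k, upward (Q k)) -> (forall k, k < m -> exists j, Q k j) ->
  exists j, forall k, k < m -> Q k j.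
Proof.
move=> upQ; elim: m => [|m IHm] exQ; first by have [j _] := s_unbounded 0; exists j.
have [k lt_km|i iQ] := IHm; first by apply: exQ; apply: ltnW.
have [j jQ] := exQ m (leqnn _); have [k [oik ojk sik sjk]] := o_directed i j.
exists k => l; rewrite ltnS leq_eqVlt => /orP [/eqP ->|/iQ]; first exact: upQ jQ.
exact: upQ.
Qed.

(** Compactness of computations: a halting computation uses finitely many oracle
    answers and finitely many searches, and these are all available at one
    member of the family, since the family is directed and [run] is monotone. *)
Lemma run_complete n (p : prog n) w r :
  eval X p (tup n w) r -> exists j, run (o j) (s j) p w = r.+1.
Proof.
have [j0 _] := s_unbounded 0.
have upR m (q : prog m) v y : upward (fun j => run (o j) (s j) q v = y.+1).
  by move=> i j oij sij; apply: run_mono.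
elim: p w r => {n} /= [n|  |n i| |m n f IHf g IHg|n f IHf g IHg|n f IHf] w r.
- by move=> ->; exists j0.
- by rewrite thead_tup => ->; exists j0.
- by rewrite tnth_tup => ->; exists j0.
- rewrite thead_tup => E; have [j jP] := o_exhaustive (w 0); exists j; rewrite jP; congr _.+1.
  by case: asboolP E => Xw [] [].
- move=> [v [gP]]; rewrite (tupE v) => /IHf [i fi].
  pose Q k j := forall l : 'I_m, l = k :> nat -> run (o j) (s j) (g l) w = (tnth v l).+1.
  have [k|k lt_km|j jQ] := @bounded_choice Q m.
  + by move=> a b oab sab Qa l lk; apply: upR (Qa l lk).
  + have [j jP] := IHg (Ordinal lt_km) _ _ (gP _).
    by exists j => l lk; rewrite (_ : l = Ordinal lt_km) //; apply: val_inj.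
  have [k [oik ojk sik sjk]] := o_directed i j; exists k.
  have gE l : run (o k) (s k) (g l) w = (tnth v l).+1 by apply: upR (jQ l _ l _).
  case: allP => [_|[] l _]; last by rewrite gE.
  rewrite (_ : (fun _ => _) = nth 0 v); first exact: upR fi.
  apply/funext => l; case: insubP => [x _ <-|]; first by rewrite gE (tnth_nth 0).
  by rewrite -leqNgt => le_ml; rewrite nth_default // size_tuple.
- rewrite thead_tup behead_tup.
  elim: (w 0) r => [|k IHk] r /=; first exact: IHf.
  move=> [y [/IHk [i iP]]]; rewrite rec_tup => /IHg [j jP].
  have [l [oil ojl sil sjl]] := o_directed i j; exists l.
  have := upR _ (PRec f g) (scons k (shift w)) y i l oil sil; rewrite /= => -> //=.
  exact: upR jP.
- rewrite cons_tup => -[/IHf [i iP] rmin].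
  have [k|k lt_kr|j jP] := @bounded_choice
      (fun k j => exists y, run (o j) (s j) f (scons k w) = y.+2) r.
  + by move=> a b oab sab [y yP]; exists y; apply: upR yP.
  + have [y] := rmin _ lt_kr; rewrite cons_tup => /IHf [j jP].
    by exists j, y.
  have [k [oik ojk sik sjk]] := o_directed i j; have [l lt_rl] := s_unbounded r.+1.
  have [h [okh olh skh slh]] := o_directed k l; exists h.
  apply/search_loopP; split; first exact: leq_trans slh.
    by apply: upR (upR _ _ _ _ _ _ oik sik iP).
  move=> x /jP [y yP]; rewrite (upR _ _ _ _ _ h _ _ yP) //.
    by move=> a b /ojk /okh.
  exact: leq_trans skh.
Qed.

End Completeness.

(** By induction on [p], the simulation can be programmed. The first two variables
    hold the bound [s] and a parameter [e] (later a finite set) of the oracle, so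
    that they are passed unchanged through all substitutions. *)
Lemma ucomp_run (O : nat -> nat -> nat -> nat) n (p : prog n) :
  ucomp 3 (fun _ w => O (w 0) (w 1) (w 2)) ->
  ucomp n.+2 (fun _ w => run (O (w 0) (w 1)) (w 0) p (fun i => w i.+2)).
Proof.
move=> OP; elim: p => {n} /= [n|  |n i| |m n f IHf g IHg|n f IHf g IHg|n f IHf].
- exact: ucomp_const.
- exact/ucomp_succ/ucomp_succ/ucomp_var.
- by apply: ucomp_succ; apply: ucomp_var; rewrite !ltnS ltn_ord.
- exact: OP.
- apply: (@ucomp_if n.+2 (fun _ w => all (fun i : 'I_m =>
      run (O (w 0) (w 1)) (w 0) (g i) (fun i => w i.+2) != 0) (enum 'I_m)));
    last exact: ucomp_const.
    apply: (@ucomp_all_seq _ _ (fun _ w (i : 'I_m) =>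
      run (O (w 0) (w 1)) (w 0) (g i) (fun i => w i.+2) != 0)) => i.
    apply: ucomp_not; apply: ucomp_eq (IHg i) (ucomp_const _ _).
  apply: (ucomp_subst (g := fun j => if j is j'.+2 then fun X w =>
    if insub j' is Some i then
      (run (O (w 0) (w 1)) (w 0) (g i) (fun i => w i.+2)).-1 else 0 else fun _ w => w j) IHf).
  move=> [|[|j]] lt_j; [exact: ucomp_var|exact: ucomp_var|].
  by case: insub => [i|]; [exact: ucomp_pred | exact: ucomp_const].
- apply: (@ucomp_rec _
    (fun _ w => run (O (w 0) (w 1)) (w 0) f (fun i => w i.+3))
    (fun _ k r w => if r == 0 then 0 else
       run (O (w 0) (w 1)) (w 0) g (scons k (scons r.-1 (fun i => w i.+3))))
    (fun _ w => w 2)); last exact: ucomp_var.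
    apply: (ucomp_subst (g := fun j _ w => w (if j is j'.+2 then j'.+3 else j)) IHf).
    by move=> [|[|j]] lt_j; apply: ucomp_var.
  apply: ucomp_if; first by apply: ucomp_eq; [apply: ucomp_var|apply: ucomp_const].
    exact: ucomp_const.
  apply: (ucomp_subst (g := fun j X w => match j with
    | 0 => w 2 | 1 => w 3 | 2 => w 0 | 3 => (w 1).-1 | j'.+4 => w j'.+4.+1 end) IHg).
  by move=> [|[|[|[|j]]]] lt_j; try apply: ucomp_pred; apply: ucomp_var.
- apply: ucomp_pred.
  apply: (@ucomp_rec _ (fun _ _ => 0)
    (fun _ k r w => if r == 0 then
       let y := run (O (w 0) (w 1)) (w 0) f (scons k (fun i => w i.+2)) in
       if y == 0 then 1 else if y == 1 then k.+2 else 0 else r)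
    (fun _ w => w 0)); [exact: ucomp_const| |exact: ucomp_var].
  have fP : ucomp n.+4 (fun _ w => run (O (w 2) (w 3)) (w 2) f
      (scons (w 0) (fun i => w i.+4))).
    apply: (ucomp_subst (g := fun j X w => match j with
      | 0 => w 2 | 1 => w 3 | 2 => w 0 | j'.+3 => w j'.+4 end) IHf).
    by move=> [|[|[|j]]] lt_j; apply: ucomp_var.
  have eqP k : ucomp n.+4 (fun _ w => run (O (w 2) (w 3)) (w 2) f
      (scons (w 0) (fun i => w i.+4)) == k).
    by apply: ucomp_eq; [|apply: ucomp_const].
  apply: ucomp_if; last exact: ucomp_var.
    by apply: ucomp_eq; [apply: ucomp_var|apply: ucomp_const].
  apply: ucomp_if => //; first exact: ucomp_const.
  apply: ucomp_if => //; last exact: ucomp_const.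
  exact/ucomp_succ/ucomp_succ/ucomp_var.
Qed.

(** * Codes of finite sets and of sequences *)

Lemma ucomp_app1 (F : nat -> nat) n a : ucomp 1 (fun _ w => F (w 0)) ->
  ucomp n a -> ucomp n (fun X w => F (a X w)).
Proof. by move=> FP aP; apply: (ucomp_subst (g := fun=> a) FP). Qed.

Lemma ucomp_app2 (F : set nat -> nat -> nat -> nat) n a b :
  ucomp 2 (fun X w => F X (w 0) (w 1)) ->
  ucomp n a -> ucomp n b -> ucomp n (fun X w => F X (a X w) (b X w)).
Proof.
move=> FP aP bP; apply: (ucomp_subst (g := nth b [:: a]) FP).
by move=> [|[|]].
Qed.

(** Definition by unique description: a bounded sum with at most one nonzero term
    picks out the described value, and yields 0 when nothing fits. This saves
    writing algorithms for halving and for decoding. *)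
Lemma ucomp_the n (P : set nat -> (nat -> nat) -> nat -> bool) b f :
  ucomp n.+1 (fun X w => P X (fun i => w i.+1) (w 0)) -> ucomp n b ->
  (forall X w k, P X w k -> k = f X w) ->
  (forall X w, f X w != 0 -> f X w < b X w /\ P X w (f X w)) ->
  ucomp n f.
Proof.
move=> PP bP Puniq Pex.
have := ucomp_sum (F := fun X w k => P X w k * k)
  (ucomp_mul PP (ucomp_var (ltn0Sn n))) bP.
apply: ucomp_ext => X w; case: (eqVneq (f X w) 0) => [f0|/Pex [lt_fb Pf]].
  rewrite f0 big1 // => k _; case Pk: (P X w k) => //.
  by rewrite (Puniq _ _ _ Pk) f0.
rewrite big_mkord (bigD1 (Ordinal lt_fb)) //= Pf mul1n big1 ?addn0 // => k neq_kf.
case Pk: (P X w k) => //; case/eqP: neq_kf; apply: val_inj; exact: Puniq Pk.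
Qed.

(** Follows the shape of the function, down to variables, constants and
    hypotheses. *)
Ltac ucomp_tac := repeat (cbv beta; match goal with
  | H : ucomp _ _ |- _ => exact: H
  | |- ucomp _ (fun _ w => w _) => by apply: ucomp_var
  | |- ucomp _ (fun _ _ => nat_of_bool (~~ _)) => apply: ucomp_not
  | |- ucomp _ (fun _ _ => nat_of_bool (_ && _)) => apply: ucomp_and
  | |- ucomp _ (fun _ _ => nat_of_bool (_ || _)) => apply: ucomp_or
  | |- ucomp _ (fun _ _ => nat_of_bool (_ <= _)) => apply: ucomp_leq
  | |- ucomp _ (fun _ _ => nat_of_bool (_ == _)) => apply: ucomp_eq
  | |- ucomp _ (fun _ _ => S _) => apply: ucomp_succ
  | |- ucomp _ (fun _ _ => predn _) => apply: ucomp_pred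
  | |- ucomp _ (fun _ _ => _ + _) => apply: ucomp_add
  | |- ucomp _ (fun _ _ => _ * _) => apply: ucomp_mul
  | |- ucomp _ (fun _ _ => 2 ^ _) => apply: ucomp_exp2
  | |- ucomp _ (fun _ _ => if _ then _ else _) => apply: ucomp_if
  | |- ucomp _ (fun _ _ => nat_of_bool (has _ (iota 0 _))) => apply: ucomp_has
  | |- ucomp _ (fun _ _ => nat_of_bool (all _ (iota 0 _))) => apply: ucomp_all
  | |- ucomp _ (fun _ _ => _) => exact: ucomp_const
  end).

Lemma ucomp_half n a : ucomp n a -> ucomp n (fun X w => (a X w)./2).
Proof.
apply: ucomp_app1.
apply: (@ucomp_the _ (fun _ w k => (w 0 == k + k) || (w 0 == (k + k).+1)) (fun _ w => w 0)).
- by ucomp_tac.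
- by ucomp_tac.
- by move=> X w k; rewrite addnn => /orP [] /eqP ->; rewrite /= ?uphalf_double ?doubleK.
- move=> X w; rewrite addnn => half0; have w0 : 0 < w 0 by case: (w 0) half0.
  split; first by rewrite ltn_half_double -addnn -[X in X < _]addn0 ltn_add2l.
  rewrite -{1 3}(odd_double_half (w 0)); by case: odd; rewrite eqxx ?orbT.
Qed.

Lemma ucomp_odd n a : ucomp n a -> ucomp n (fun X w => odd (a X w)).
Proof.
apply: (@ucomp_app1 (fun k => odd k)).
have hP := ucomp_half (@ucomp_var 1 0 isT).
have : ucomp 1 (fun _ w => ~~ (w 0 == (w 0)./2 + (w 0)./2)) by ucomp_tac.
apply: ucomp_ext => X w; rewrite addnn -{1}(odd_double_half (w 0)) -{2}[_.*2]add0n eqn_add2r.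
by case: odd.
Qed.

Definition bit (e x : nat) : bool := odd (e %/ 2 ^ x).

Lemma ucomp_bit n a b : ucomp n a -> ucomp n b -> ucomp n (fun X w => bit (a X w) (b X w)).
Proof.
apply: (@ucomp_app2 (fun _ e x => bit e x)); apply: ucomp_odd.
have hP := ucomp_half (@ucomp_var 4 1 isT).
have := ucomp_rec (st := fun _ _ r _ => r./2) (@ucomp_var 2 0 isT) hP (@ucomp_var 2 1 isT).
apply: ucomp_ext => X w /=; elim: (w 1) => [|k /= ->]; first by rewrite divn1.
by rewrite -divn2 -divnMA -expnSr.
Qed.

Lemma bit_ltn e x : bit e x -> x < e.
Proof.
apply: contraLR; rewrite -leqNgt => le_ex.
by rewrite /bit divn_small // (leq_ltn_trans le_ex) // ltn_expl.
Qed.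

(** By induction on the bound: [P 0] is the lowest digit, and the other digits are
    given by the shifted predicate. *)
Lemma bit_comprehension b (P : nat -> bool) : exists e, forall x, bit e x = (x < b) && P x.
Proof.
elim: b P => [|b IHb] P; first by exists 0 => x; rewrite /bit div0n.
have [e eP] := IHb (fun x => P x.+1); exists (P 0 + e.*2) => -[|x].
  by rewrite /bit divn1 oddD odd_double addbF oddb.
rewrite /bit expnS divnMA divn2 halfD odd_double andbF doubleK.
by case: (P 0); exact: eP.
Qed.

Definition pair_code i x := CodeSeq.code [:: i; x].
Definition code_head x := head 0 (CodeSeq.decode x).
Definition code_tail x := CodeSeq.code (behead (CodeSeq.decode x)).

(** The code of [i :: s] is [2 ^ i] times an odd number, which determines [i] and
    [s]; this makes decoding a unique description. *)
Lemma code_head_tail x : x = 0 \/ x = 2 ^ code_head x * (code_tail x + code_tail x).+1.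
Proof.
rewrite addnn /code_tail /code_head -{1 2}(CodeSeq.decodeK x).
by case: (CodeSeq.decode x) => [|i s]; [left | right].
Qed.

Lemma code_head_tail_unique x i y : x = 2 ^ i * (y + y).+1 -> code_head x = i /\ code_tail x = y.
Proof.
rewrite addnn -{1}(CodeSeq.decodeK y) => xE.
by rewrite /code_tail /code_head xE (CodeSeq.codeK (i :: CodeSeq.decode y)) /= CodeSeq.decodeK.
Qed.

Lemma code_head_tail_ltn x : x != 0 -> code_head x < x /\ code_tail x < x.
Proof.
case: (code_head_tail x) => [-> //|xE _]; rewrite {2 4}xE; split.
  by rewrite (leq_trans (ltn_expl _ (ltnSn 1))) // leq_pmulr.
by rewrite (leq_trans _ (leq_pmull _ _)) ?expn_gt0 // ltnS leq_addr.
Qed.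

Lemma ucomp_code_head n a : ucomp n a -> ucomp n (fun X w => code_head (a X w)).
Proof.
apply: ucomp_app1.
apply: (@ucomp_the _ (fun _ w i => has (fun y => w 0 == 2 ^ i * (y + y).+1) (iota 0 (w 0)))
  (fun _ w => w 0)).
- by ucomp_tac.
- by ucomp_tac.
- by move=> X w k /hasP [y _ /eqP /code_head_tail_unique []].
- move=> X w; case: (code_head_tail (w 0)) => [-> //|xE h0].
  have x0 : w 0 != 0 by apply: contraNneq h0 => ->.
  have [lt_h lt_t] := code_head_tail_ltn x0; split=> //.
  by apply/hasP; exists (code_tail (w 0)); rewrite ?mem_iota // -xE.
Qed.

Lemma ucomp_code_tail n a : ucomp n a -> ucomp n (fun X w => code_tail (a X w)).
Proof.
apply: ucomp_app1.
apply: (@ucomp_the _ (fun _ w y => has (fun i => w 0 == 2 ^ i * (y + y).+1) (iota 0 (w 0)))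
  (fun _ w => w 0)).
- by ucomp_tac.
- by ucomp_tac.
- by move=> X w k /hasP [y _ /eqP /code_head_tail_unique []].
- move=> X w; case: (code_head_tail (w 0)) => [-> //|xE h0].
  have x0 : w 0 != 0 by apply: contraNneq h0 => ->.
  have [lt_h lt_t] := code_head_tail_ltn x0; split=> //.
  by apply/hasP; exists (code_head (w 0)); rewrite ?mem_iota // -xE.
Qed.

Definition code_second x := code_head (code_tail x).
Definition is_pair n := n == pair_code (code_head n) (code_second n).

Lemma code_headK i x : code_head (pair_code i x) = i.
Proof. by rewrite /code_head CodeSeq.codeK. Qed.

Lemma code_secondK i x : code_second (pair_code i x) = x.
Proof. by rewrite /code_second /code_tail /code_head !CodeSeq.codeK. Qed.

Lemma is_pairP n : reflect (exists i x, n = pair_code i x) (is_pair n).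
Proof.
apply: (iffP eqP) => [->|[i [x ->]]]; first by do 2!eexists.
by rewrite code_headK code_secondK.
Qed.

Lemma ucomp_pair_code n a b : ucomp n a -> ucomp n b ->
  ucomp n (fun X w => pair_code (a X w) (b X w)).
Proof.
move=> aP bP; rewrite /pair_code /=; under eq_fun => X do under eq_fun => w do
  rewrite muln1 -addnn. by ucomp_tac.
Qed.

Lemma ucomp_is_pair n a : ucomp n a -> ucomp n (fun X w => is_pair (a X w)).
Proof.
move=> aP; apply: ucomp_eq => //.
by apply: ucomp_pair_code; [exact: ucomp_code_head | exact/ucomp_code_head/ucomp_code_tail].
Qed.

(** The length is read off iterated tails, since only the empty sequence has
    code 0. *)
Lemma size_decodeE k x :
  (size (CodeSeq.decode x) == k) =
  (iter k code_tail x == 0) && ((k == 0) || (iter k.-1 code_tail x != 0)).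
Proof.
have iterE j : iter j code_tail x = CodeSeq.code (drop j (CodeSeq.decode x)).
  elim: j => [|j IHj]; first by rewrite drop0 CodeSeq.decodeK.
  by rewrite iterS IHj /code_tail CodeSeq.codeK -[j.+1]add1n -drop_drop drop1.
have code0 s : (CodeSeq.code s == 0) = nilp s.
  by case: s => //= i s; rewrite muln_eq0 expn_eq0.
rewrite !iterE !code0 /nilp !size_drop; case: k => [|k] /=; first by rewrite subn0 andbT.
by rewrite !subn_eq0 -ltnNge eqn_leq.
Qed.

Lemma ucomp_size_decode n a b : ucomp n a -> ucomp n b ->
  ucomp n (fun X w => size (CodeSeq.decode (a X w)) == b X w).
Proof.
apply: (@ucomp_app2 (fun _ x k => size (CodeSeq.decode x) == k)).
have iterP c : ucomp 2 c -> ucomp 2 (fun X w => iter (c X w) code_tail (w 0)).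
  move=> cP; have tP := ucomp_code_tail (@ucomp_var 4 1 isT).
  apply: ucomp_ext (ucomp_rec (st := fun _ _ r _ => code_tail r) (@ucomp_var 2 0 isT) tP cP).
  by move=> X w; elim: (c X w) => //= k ->.
have i1 := iterP _ (@ucomp_var 2 1 isT).
have i2 := iterP _ (ucomp_pred (@ucomp_var 2 1 isT)).
have : ucomp 2 (fun _ w => (iter (w 1) code_tail (w 0) == 0) &&
  ((w 1 == 0) || ~~ (iter (w 1).-1 code_tail (w 0) == 0))) by ucomp_tac.
by apply: ucomp_ext => X w; rewrite size_decodeE.
Qed.

(** * From computations to enumerations *)

Lemma fin_set_bit e x : fin_set e x = bit e x.
Proof. by []. Qed.

(** An answer [v] stands for a formula about [X]: 0 is false, 1 is true, and
    [b.+2] is the statement that [b] belongs to [X]. *)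
Definition query_holds (X : set nat) (v : nat) := v = 1 \/ exists b, v = b.+2 /\ X b.

(** The complement of [X] is obtained from [X] by a positive existential
    condition with one query per witness; when [c] is computable, any
    enumeration of [X] thus yields an enumeration of the complement of [X]. *)
Definition co_query (c : nat -> nat -> nat) (X : set nat) :=
  forall a, ~ X a <-> exists t, query_holds X (c a t).

Definition ucomp2 (c : nat -> nat -> nat) := ucomp 2 (fun _ w => c (w 0) (w 1)).

Lemma ucomp_comp2 c n a b : ucomp2 c -> ucomp n a -> ucomp n b ->
  ucomp n (fun X w => c (a X w) (b X w)).
Proof. exact: (@ucomp_app2 (fun=> c)). Qed.

Section FromComputationToEnumeration.
Variable c : nat -> nat -> nat.
Hypothesis cP : ucomp2 c.

(** The partial oracle given by the finite set with index [e]: a positive answer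
    comes from [e] itself, a negative one from a witness below [s] that [e]
    confirms. *)
Definition fin_oracle (s e a : nat) : nat :=
  if bit e a then 2 else
  if has (fun t => (c a t == 1) || ((1 < c a t) && bit e (c a t).-1.-1)) (iota 0 s)
  then 1 else 0.

Lemma ucomp_fin_oracle : ucomp 3 (fun _ w => fin_oracle (w 0) (w 1) (w 2)).
Proof.
have b1 : ucomp 3 (fun _ w => bit (w 1) (w 2)) by apply: ucomp_bit; apply: ucomp_var.
have c1 : ucomp 4 (fun _ w => c (w 3) (w 0)) by apply: ucomp_comp2 => //; apply: ucomp_var.
have b2 : ucomp 4 (fun _ w => bit (w 2) (c (w 3) (w 0)).-1.-1).
  by apply: ucomp_bit; [apply: ucomp_var | do 2!apply: ucomp_pred].
by rewrite /fin_oracle; ucomp_tac.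
Qed.

Variable X : set nat.
Hypothesis cX : co_query c X.

Lemma fin_oracle_approximates s e : fin_set e `<=` X -> approximates X (fin_oracle s e).
Proof.
move=> eX a b; rewrite /fin_oracle; case: ifP => [ea [<-]|_].
  by rewrite (asboolT (eX _ ea)).
case: hasP => // -[t _ /orP tP] [<-]; rewrite asboolF //; apply/cX.
exists t; case: tP => [/eqP|/andP [lt1c ec]]; [by left | right].
exists (c a t).-1.-1; split; last exact: eX.
by case: (c a t) lt1c => [|[]].
Qed.

(** The larger finite set must be part of [X]: otherwise it could contain a point
    that the smaller one puts in the complement. *)
Lemma fin_oracle_mono s s' e e' :
  s <= s' -> fin_set e `<=` fin_set e' -> fin_set e' `<=` X ->
  oracle_le (fin_oracle s e) (fin_oracle s' e').
Proof.
move=> ss' ee' e'X a b oab.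
have bE := fin_oracle_approximates (subset_trans ee' e'X) oab.
have {}ee' x : bit e x -> bit e' x by exact: ee'.
case o'E: (fin_oracle s' e' a) => [|b']; last by rewrite (fin_oracle_approximates e'X o'E) bE.
move: oab o'E; rewrite /fin_oracle; case: ifP => [/ee' -> //|_].
case: ifP => // /hasP [t]; rewrite mem_iota /= => lt_ts tP _; case: ifP => // _.
case: hasP => // -[]; exists t; first by rewrite mem_iota (leq_trans lt_ts).
by case/orP: tP => [->//|/andP [-> /ee' ->]]; rewrite orbT.
Qed.

(** The finite parts of [X] form a directed family, and every query is answered
    correctly by one of them: by a singleton if the answer is positive or if the
    negative answer has a witness with a query, by the empty set otherwise. *)
Lemma fin_oracle_complete (Phi : prog 1) x r : eval X Phi [tuple x] r ->
  exists s e, fin_set e `<=` X /\ run (fin_oracle s e) s Phi (fun=> x) = r.+1.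
Proof.
have single b : X b -> exists2 e, fin_set e `<=` X & bit e b.
  move=> Xb; have [e eP] := bit_comprehension b.+1 (pred1 b).
  exists e; last by rewrite eP ltnSn /=.
  by move=> y; rewrite fin_set_bit eP => /andP [_ /eqP ->].
pose J := {j : nat * nat | fin_set j.2 `<=` X}.
pose o (j : J) := fin_oracle (sval j).1 (sval j).2.
rewrite tup1 => /(@run_complete X J o (fun j => (sval j).1)) [].
- move=> [[s e] /= eX] [[s' e'] /= e'X].
  have [u uP] := bit_comprehension (e + e') (fun x => bit e x || bit e' x).
  (* [u] indexes the union of the two finite sets. *)
  have uX : fin_set u `<=` X.
    by move=> y; rewrite fin_set_bit uP => /andP [_ /orP [/eX|/e'X]].
  exists (exist _ (maxn s s', u) uX); split=> /=; rewrite ?leq_maxl ?leq_maxr //.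
    apply: (@fin_oracle_mono s _ e u) => //; first exact: leq_maxl.
    by move=> y; rewrite !fin_set_bit uP => ey; rewrite ey ltn_addr ?bit_ltn.
  apply: (@fin_oracle_mono s' _ e' u) => //; first exact: leq_maxr.
  by move=> y; rewrite !fin_set_bit uP => ey; rewrite ey orbT ltn_addl ?bit_ltn.
- move=> N; have e0X : fin_set 0 `<=` X by move=> y; rewrite fin_set_bit /bit div0n.
  by exists (exist _ (N, 0) e0X).
- move=> a; suff [s [e eX oE]] : exists s, exists2 e, fin_set e `<=` X & fin_oracle s e a != 0.
    exists (exist _ (s, e) eX); rewrite /o /=; case E: fin_oracle oE => [|b] // _.
    by rewrite (fin_oracle_approximates eX E).
  case: (pselect (X a)) => [/single [e eX ea]|nXa].
    by exists 0, e => //; rewrite /fin_oracle ea.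
  have [t [ct1|[b [cb /single [e eX eb]]]]] := (cX a).1 nXa; exists t.+1.
    exists 0; first by move=> y; rewrite fin_set_bit /bit div0n.
    rewrite /fin_oracle; case: ifP => // _; case: hasP => // -[]; exists t.
      by rewrite mem_iota ltnSn.
    by rewrite ct1.
  exists e => //; rewrite /fin_oracle; case: ifP => // _; case: hasP => // -[]; exists t.
    by rewrite mem_iota ltnSn.
  by rewrite cb /= eb.
- by move=> [[s e] eX] jP; exists s, e.
Qed.

End FromComputationToEnumeration.

(** The operator enumerates [n] from a finite set [e] as soon as the simulation of
    [Phi] with the oracle information in [e] accepts [n]. This uses no negative
    information on [X], as negative answers come from positive ones by [c]. *)
Lemma enum_of_computation c (Phi : prog 1) : ucomp2 c ->
  exists Psi : enum_op, forall X, co_query c X ->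
    enum_app Psi X = [set n | eval X Phi [tuple n] 1].
Proof.
move=> cP.
pose R s m := run (fin_oracle c s (code_head m)) s Phi (fun=> code_second m).
pose W : set nat := [set m | is_pair m /\ exists s, R s m = 2].
have W_ce : ce W.
  have RP : ucomp 2 (fun _ w => R (w 0) (w 1)).
    apply: (ucomp_subst (g := fun i _ w => match i with
      0 => w 0 | 1 => code_head (w 1) | _ => code_second (w 1) end)
      (ucomp_run Phi (ucomp_fin_oracle cP))).
    move=> [|[|i]] _; [exact: ucomp_var | exact/ucomp_code_head/ucomp_var |].
    exact/ucomp_code_head/ucomp_code_tail/ucomp_var.
  have iP : ucomp 2 (fun _ w => is_pair (w 1)) by apply/ucomp_is_pair/ucomp_var.
  have PP : ucomp 2 (fun _ w => is_pair (w 1) && (R (w 0) (w 1) == 2)) by ucomp_tac.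
  have [p pP] := search_program PP (ucomp_const 2 0); exists p; apply/seteqP; split=> m /=.
    move=> [mP [s sP]]; have [] := (pP set0 (fun=> m)).1.
      by exists s; rewrite /= mP sP.
    by move=> z [_]; rewrite -tup1 => zP; exists 0.
  by rewrite tup1 => -[r /(pP _ _).2 [z /= /andP [mP /eqP zP]]]; split=> //; exists z.
exists (EnumOp W_ce) => X cX; apply/seteqP; split=> x /=.
  move=> [e [eX [_ [s]]]]; rewrite /R (code_headK e x) (code_secondK e x) tup1.
  exact/run_sound/fin_oracle_approximates.
move=> /(fin_oracle_complete cX) [s [e [eX sP]]]; exists e; split=> //; split.
  by apply/is_pairP; exists e, x.
by exists s; rewrite /R (code_headK e x) (code_secondK e x).
Qed.

(** A code [n] is in the graph iff it is the pair of its first component [x] and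
    of the value computed at [x]. *)
Lemma graph_decision (Phi : prog 1) : exists Q : prog 1, forall X g,
  computes_fun Phi X g -> computes_set Q X (graph g).
Proof.
have [ph phP] := ucomp_code_head (@ucomp_var 1 0 isT).
have hP := ucomp_pair_code (ucomp_code_head (@ucomp_var 2 0 isT)) (@ucomp_var 2 1 isT).
have [pt ptP] := ucomp_eq (@ucomp_var 2 0 isT) hP.
exists (PComp pt (fun i => if i == ord0 then PProj ord0 else PComp Phi (fun=> ph))) => X g gP n.
suff ev (r : nat) : r = (n == pair_code (code_head n) (g (code_head n))) ->
    eval X (PComp pt (fun i => if i == ord0 then PProj ord0 else PComp Phi (fun=> ph)))
      [tuple n] r.
  split=> [[x _ nx]|nG]; apply: ev.
    by rewrite -nx -/(pair_code x (g x)) code_headK eqxx.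
  by case: eqP => // nE; case: nG; exists (code_head n).
move=> ->.
exists (tup 2 (fun i => if i == 0 then n else g (code_head n))); split; last exact: ptP.
move=> i; rewrite tnth_tup; case: (unliftP ord0 i) => [j|] -> /=; last by rewrite tnth0.
exists [tuple code_head n]; split; last exact: gP.
by move=> k; rewrite ord1 tnth0 tup1; apply: phP.
Qed.

(** * From enumerations to computations *)

(** Kleene normal form: halting without an oracle is the existence of a stage of a
    total computable simulation. It does not depend on the oracle at hand, so it
    is available inside any relativized computation. *)
Lemma oracle_free_stages (p : prog 1) : exists rho : nat -> nat -> nat,
  [/\ ucomp2 rho,
      forall n r, eval set0 p [tuple n] r <-> exists s, rho s n = r.+1
    & forall s s' n r, s <= s' -> rho s n = r.+1 -> rho s' n = r.+1].
Proof.
exists (fun s n => run (fun=> 1) s p (fun=> n)); split.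
- apply: (ucomp_subst (g := fun i _ w => if i is 0 then w 0 else w 1)
    (@ucomp_run (fun _ _ _ => 1) _ p (ucomp_const _ _))).
  by move=> [|i] _; apply: ucomp_var.
- move=> n r; rewrite tup1; split.
    move=> /(@run_complete set0 nat (fun _ _ => 1) id); apply.
    + by move=> i j; exists (maxn i j); split; rewrite ?leq_maxl ?leq_maxr.
    + by move=> N; exists N.
    + by move=> a; exists 0; case: asboolP.
  by move=> [s]; apply: run_sound => a b [<-]; case: asboolP.
- by move=> s s' n r; apply: run_mono.
Qed.

(** The value is found by a search for a stage at which the simulation has one; so
    no use is made of the oracle of the surrounding program. *)
Lemma ucomp_computable g n a : computable g -> ucomp n a -> ucomp n (fun X w => g (a X w)).
Proof.
move=> [p pP]; apply: ucomp_app1; have [rho [rhoP rhoE _]] := oracle_free_stages p.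
have PP : ucomp 2 (fun _ w => ~~ (rho (w 0) (w 1) == 0)) by ucomp_tac.
have [q qP] := search_program PP (ucomp_pred rhoP); exists q => X w.
have [s sP] := (rhoE _ _).1 (pP (w 0)).
have [|z [/= z0]] := (qP X w).1; first by exists s; rewrite /= sP.
case zE: (rho z (w 0)) z0 => [|r] // _; rewrite -(_ : r = g (w 0)) //.
by apply: eval_functional (pP _); apply/rhoE; exists z.
Qed.

(** Enumeration by stages: at stage [z], the axioms that have appeared, and whose
    finite set has an index below [z], are tested against [X]. *)
Lemma enum_stages (Psi : enum_op) : exists E : set nat -> nat -> nat -> bool,
  [/\ ucomp 2 (fun X w => E X (w 0) (w 1)),
      forall X x, enum_app Psi X x <-> exists z, E X z x
    & forall X x z z', z <= z' -> E X z x -> E X z' x].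
Proof.
case: Psi => W [p WE]; have [rho [rhoP rhoE rhoM]] := oracle_free_stages p.
exists (fun X z x => has (fun e => all (fun b => ~~ bit e b || `[< X b >]) (iota 0 e) &&
  ~~ (rho z (pair_code e x) == 0)) (iota 0 z)); split.
- have bP : ucomp 4 (fun _ w => bit (w 1) (w 0)) by apply: ucomp_bit; apply: ucomp_var.
  have XP : ucomp 4 (fun X w => `[< X (w 0) >]) by apply/ucomp_oracle/ucomp_var.
  have rP : ucomp 3 (fun _ w => rho (w 1) (pair_code (w 0) (w 2))).
    by apply: ucomp_comp2 => //; [|apply: ucomp_pair_code]; apply: ucomp_var.
  by ucomp_tac.
- move=> X x; rewrite /enum_app /= WE; split.
    move=> [e [eX [r /rhoE [s sP]]]]; exists (maxn e.+1 s); apply/hasP; exists e.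
      by rewrite mem_iota leq_maxl.
    apply/andP; split; last by rewrite (rhoM s _ _ r) // leq_maxr.
    by apply/allP => b _; rewrite -implybE; apply/implyP => /eX Xb; apply/asboolP.
  move=> [z /hasP [e _ /andP [/allP eX rP]]]; exists e; split.
    move=> b eb; have := eX b; rewrite mem_iota /= (bit_ltn eb) => /(_ isT).
    by rewrite (eb : bit e b) => /asboolP.
  case rE: (rho z (pair_code e x)) rP => [|r] // _.
  by exists r; apply/rhoE; exists z.
- move=> X x z z' zz' /hasP [e]; rewrite mem_iota /= => lt_ez /andP [eX rP].
  apply/hasP; exists e; first by rewrite mem_iota (leq_trans lt_ez).
  rewrite eX /=; case rE: (rho z (pair_code e x)) rP => [|r] // _.
  by rewrite (rhoM _ _ _ _ zz' rE).
Qed.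

(** Post's theorem, relativized: as [Y] is enumerated from [X] and the complement
    of [Y] is enumerated from [Y], one searches for a stage that decides [n]. *)
Lemma decision_of_enum c (Psi : enum_op) : ucomp2 c ->
  exists Phi : turing_op, forall X Y, co_query c Y -> enum_app Psi X = Y ->
    computes_set Phi X Y.
Proof.
move=> cP; have [E [EP EE EM]] := enum_stages Psi.
have c1 : ucomp 3 (fun _ w => c (w 2) (w 0)) by apply: ucomp_comp2 => //; apply: ucomp_var.
have E1 : ucomp 3 (fun X w => E X (w 1) (c (w 2) (w 0)).-1.-1).
  apply: (@ucomp_app2 (fun X a b => E X a b)) => //; first exact: ucomp_var.
  exact/ucomp_pred/ucomp_pred.
have PP : ucomp 2 (fun X w => E X (w 0) (w 1) ||
    has (fun t => (c (w 1) t == 1) || ((1 < c (w 1) t) && E X (w 0) (c (w 1) t).-1.-1))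
      (iota 0 (w 0))) by ucomp_tac.
have [Phi PhiP] := search_program PP EP; exists Phi => X Y cY YE n; rewrite tup1.
have EY x : (exists z, E X z x) <-> Y x by rewrite -YE; apply: iff_sym; apply: EE.
have [|z [/= zP ev]] := (PhiP X (fun=> n)).1.
  case: (pselect (Y n)) => [/EY [z zP]|/cY [t tP]]; first by exists z; rewrite /= zP.
  case: tP => [ct|[b [ct /EY [z zP]]]].
    exists t.+1; apply/orP; right; apply/hasP; exists t; first by rewrite mem_iota /= ltnSn.
    by rewrite /= ct.
  exists (maxn t.+1 z); apply/orP; right; apply/hasP; exists t.
    by rewrite mem_iota /= leq_maxl.
  by rewrite /= ct /= (EM _ _ _ _ _ zP) // leq_maxr.
move: zP; case: (boolP (E X z n)) ev => [Ez ev _|_ ev /= /hasP [t _ tP]].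
  by split=> // -[]; apply/EY; exists z.
split=> // Yn; suff : ~ Y n by [].
apply/cY; exists t; case/orP: tP => [/eqP|/andP [lt1c Ec]]; [by left | right].
exists (c n t).-1.-1; split; first by case: (c n t) lt1c => [|[]].
by apply/EY; exists z.
Qed.

(** A value of [g] is found by enumerating the graph until a pair with the given
    first component shows up. *)
Lemma function_of_enum (Psi : enum_op) : exists Phi : turing_op, forall X g,
  enum_app Psi X = graph g -> computes_fun Phi X g.
Proof.
have [E [EP EE EM]] := enum_stages Psi.
have E1 : ucomp 3 (fun X w => E X (w 1) (pair_code (w 2) (w 0))).
  apply: (@ucomp_app2 (fun X a b => E X a b)) => //; first exact: ucomp_var.
  by apply: ucomp_pair_code; apply: ucomp_var.
have PP : ucomp 2 (fun X w => has (fun y => E X (w 0) (pair_code (w 1) y)) (iota 0 (w 0))).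
  by ucomp_tac.
(* At most one [y] contributes to the sum, so the sum is that [y]. *)
have hP : ucomp 2 (fun X w => \sum_(0 <= y < w 0) E X (w 0) (pair_code (w 1) y) * y).
  apply: (ucomp_sum (F := fun X w y => E X (w 0) (pair_code (w 1) y) * y)); last exact: ucomp_var.
  by ucomp_tac.
have [Phi PhiP] := search_program PP hP; exists Phi => X g gE n; rewrite tup1.
have Eg z y : E X z (pair_code n y) -> y = g n.
  move=> zP; have : graph g (pair_code n y) by rewrite -gE; apply/EE; exists z.
  move=> [x _ nx]; have := congr1 code_head nx; rewrite (code_headK x (g x)) code_headK => xn.
  by have := congr1 code_second nx; rewrite (code_secondK x (g x)) code_secondK xn.
have [|z [/hasP [y /=]]] := (PhiP X (fun=> n)).1.
  have /EE [z zP] : enum_app Psi X (pair_code n (g n)) by rewrite gE; exists n.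
  exists (maxn (g n).+1 z); apply/hasP; exists (g n).
    by rewrite mem_iota /= leq_maxl.
  by apply: EM zP; rewrite leq_maxr.
rewrite mem_iota /= add0n => lt_yz zP; rewrite big_mkord (bigD1 (Ordinal lt_yz)) //= zP mul1n.
rewrite big1 ?addn0 ?(Eg _ _ zP) // => k neq_ky; case Ek: (E X z _) => //.
by case/eqP: neq_ky; apply: val_inj; rewrite /= (Eg _ _ Ek) (Eg _ _ zP).
Qed.

(** * Joins, graphs and diagrams *)

Lemma join_bit X Y (b : bool) x : join X Y (b + x.*2) <-> (if b then Y else X) x.
Proof.
have inj (c : bool) y : c + y.*2 = b + x.*2 -> c = b /\ y = x.
  move=> E; split; first by have := congr1 odd E; rewrite !oddD !odd_double !addbF !oddb.
  by have := congr1 half E; rewrite !half_bit_double.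
split=> [[] [y Zy yE]|]; last by case: b {inj} => Zx; [right | left]; exists x.
  by have [<- <-] := inj false y yE.
by have [<- <-] := inj true y yE.
Qed.

(** Translation of an answer about one side of a join to one about the join. *)
Definition relay (b : bool) (v : nat) : nat :=
  if v <= 1 then v else (b + (v.-1.-1 + v.-1.-1)).+2.

Definition join_query (c1 c2 : nat -> nat -> nat) (a t : nat) : nat :=
  relay (odd a) (if odd a then c2 a./2 t else c1 a./2 t).

Lemma ucomp_join_query c1 c2 : ucomp2 c1 -> ucomp2 c2 -> ucomp2 (join_query c1 c2).
Proof.
move=> c1P c2P; rewrite /ucomp2.
have hP : ucomp 2 (fun _ w => (w 0)./2) by apply/ucomp_half/ucomp_var.
have oP : ucomp 2 (fun _ w => odd (w 0)) by apply/ucomp_odd/ucomp_var.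
have h1 : ucomp 2 (fun _ w => c1 (w 0)./2 (w 1)).
  by apply: ucomp_comp2 => //; apply: ucomp_var.
have h2 : ucomp 2 (fun _ w => c2 (w 0)./2 (w 1)).
  by apply: ucomp_comp2 => //; apply: ucomp_var.
by rewrite /join_query /relay; ucomp_tac.
Qed.

Lemma join_co_query c1 c2 X Y : co_query c1 X -> co_query c2 Y ->
  co_query (join_query c1 c2) (join X Y).
Proof.
move=> cX cY a; have joinE := join_bit X Y.
have relayP b v : query_holds (join X Y) (relay b v) <-> query_holds (if b then Y else X) v.
  case: v => [|[|v]]; [by split=> -[|[x []]] | by split; left |].
  rewrite /relay /= addnn /query_holds; split=> -[//|[x [[<-] Zx]]]; right.
    by exists v; split=> //; apply/joinE.
  by eexists; split=> //; apply/joinE.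
rewrite -{1}(odd_double_half a) joinE /join_query.
have {cX cY}: ~ (if odd a then Y else X) a./2 <-> exists t,
    query_holds (if odd a then Y else X) (if odd a then c2 a./2 t else c1 a./2 t).
  by case: (odd a); [apply: cY | apply: cX].
by move=> ->; split=> -[t tP]; exists t; apply/relayP.
Qed.

(** A number is outside the graph iff it codes no pair or the graph contains
    another pair with the same first component: [t] guesses the second one. *)
Definition graph_query (a t : nat) : nat :=
  if ~~ is_pair a then 1 else if t == code_second a then 0 else (pair_code (code_head a) t).+2.

Lemma ucomp_graph_query : ucomp2 graph_query.
Proof.
have iP : ucomp 2 (fun _ w => is_pair (w 0)) by apply/ucomp_is_pair/ucomp_var.
have sP : ucomp 2 (fun _ w => code_second (w 0)) by apply/ucomp_code_head/ucomp_code_tail/ucomp_var.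
have pP : ucomp 2 (fun _ w => pair_code (code_head (w 0)) (w 1)).
  by apply: ucomp_pair_code; [apply/ucomp_code_head|]; apply: ucomp_var.
by rewrite /ucomp2 /graph_query; ucomp_tac.
Qed.

Lemma graph_pair_code f x y : graph f (pair_code x y) <-> y = f x.
Proof.
split=> [[x' _ E]|->]; last by exists x.
have := congr1 code_head E; have := congr1 code_second E.
by rewrite (code_secondK x' (f x')) (code_headK x' (f x')) code_secondK code_headK => <- <-.
Qed.

Lemma graph_co_query f : co_query graph_query (graph f).
Proof.
move=> a; rewrite /graph_query; case: is_pairP => [[x [y ->]]|npair] /=.
  rewrite code_headK code_secondK graph_pair_code; split=> [nyf|[t]].
    exists (f x); rewrite eq_sym; case: eqP => // _; right.
    by exists (pair_code x (f x)); split=> //; apply/graph_pair_code.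
  by case: eqP => [_ [|[b []]]|ty [|[b [[<-] /graph_pair_code tf]]]] // yf; rewrite -yf in tf.
split=> [_|_ [x _ aE]]; first by exists 0; left.
by apply: npair; exists x, (f x).
Qed.

Section Diagram.
Variable L : language.

Definition well_formed (a : nat) : bool :=
  is_pair a./2 && (size (CodeSeq.decode (code_second a./2)) == L (code_head a./2)).

(** An atomic statement and its negation sit at [2 k] and [2 k + 1] in the
    diagram. *)
Definition flip (a : nat) : nat := if odd a then a.-1 else a.+1.

(** A number outside the diagram either is no atomic statement of the language,
    which is decidable because the arity function is computable, or is the
    negation of a statement in the diagram. *)
Definition diagram_query (a _ : nat) : nat :=
  if well_formed a then (flip a).+2 else 1.

Lemma ucomp_diagram_query : ucomp2 diagram_query.
Proof.
have hP : ucomp 2 (fun _ w => (w 0)./2) by apply/ucomp_half/ucomp_var.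
have oP : ucomp 2 (fun _ w => odd (w 0)) by apply/ucomp_odd/ucomp_var.
have pP : ucomp 2 (fun _ w => is_pair (w 0)./2) by apply/ucomp_is_pair.
have sP : ucomp 2 (fun _ w =>
    size (CodeSeq.decode (code_second (w 0)./2)) == L (code_head (w 0)./2)).
  apply: ucomp_size_decode; first exact/ucomp_code_head/ucomp_code_tail.
  exact/(ucomp_computable (arity_computable L))/ucomp_code_head.
by rewrite /ucomp2 /diagram_query /well_formed /flip; ucomp_tac.
Qed.

Variable A : structure L.

(** The number in a diagram of a statement about [t] and the [i]-th relation,
    negated if [b]. *)
Definition atom (b : bool) i (t : (L i).-tuple nat) : nat :=
  b + (pair_code i (CodeSeq.code t)).*2.

Lemma well_formedP a : well_formed a <-> exists b i t, a = @atom b i t.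
Proof.
split=> [/andP [/eqP aP sP]|[b [i [t ->]]]].
  exists (odd a), (code_head a./2), (Tuple sP).
  by rewrite /atom /= CodeSeq.decodeK -aP odd_double_half.
rewrite /well_formed /atom halfD odd_double andbF doubleK.
have -> : b./2 = 0 by case: b.
rewrite !add0n code_headK code_secondK CodeSeq.codeK size_tuple eqxx andbT.
by apply/is_pairP; do 2!eexists.
Qed.

Lemma bigjoin_code (B : forall i, set ((L i).-tuple nat)) i (t : (L i).-tuple nat) :
  bigjoin (fun i => [set CodeSeq.code (tval t) | t in B i])
    (pair_code i (CodeSeq.code t)) <-> B i t.
Proof.
split=> [[j [x [[u Bu uE] E]]]|Bt]; last by exists i, (CodeSeq.code t); split=> //; exists t.
have := congr1 code_head E; have := congr1 code_second E;
rewrite code_secondK code_headK (code_secondK j x) (code_headK j x) => xE ij.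
subst j x; move/(can_inj CodeSeq.codeK): xE => /val_inj tu.
by rewrite tu.
Qed.

Lemma diagram_atom b i (t : (L i).-tuple nat) :
  diagram A (atom b t) <-> if b then ~ A t else A t.
Proof.
apply: iff_trans (join_bit _ _ _ _) _; case: b; last exact: bigjoin_code.
exact: (bigjoin_code (fun i => ~` @A i)).
Qed.

Lemma diagram_well_formed a : diagram A a -> well_formed a.
Proof.
move=> Da; apply/well_formedP.
by case: Da => -[_ [i [x [[t _ <-] ->]]] <-]; [exists false, i, t | exists true, i, t].
Qed.

Lemma flip_atom b i (t : (L i).-tuple nat) : flip (atom b t) = atom (~~ b) t.
Proof. by rewrite /flip /atom oddD odd_double addbF oddb; case: b. Qed.

Lemma diagram_co_query : co_query diagram_query (diagram A).
Proof.
move=> a; rewrite /diagram_query; case: ifP => wf; last first.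
  split=> _; first by exists 0; left.
  by move/diagram_well_formed; rewrite wf.
have [b [i [t ->]]] := (well_formedP a).1 wf; rewrite flip_atom; split=> [nD|[_ [//|]]].
  exists 0; right; exists (atom (~~ b) t); split=> //; apply/diagram_atom.
  move: nD; have := diagram_atom b t; case: b => /= -> //.
  by apply: contrapT.
move=> [_ [[<-]]]; move/diagram_atom => D /diagram_atom; move: D.
by case: b.
Qed.

End Diagram.

Definition iso_oracle_query (L : language) : nat -> nat -> nat :=
  join_query (join_query (diagram_query L) graph_query) (diagram_query L).

Lemma iso_oracle_co_query (L : language) (A B : structure L) f :
  co_query (iso_oracle_query L) (join (join (diagram A) (graph f)) (diagram B)).
Proof.
apply: join_co_query (diagram_co_query B); apply: join_co_query (graph_co_query f).
exact: diagram_co_query.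
Qed.

Lemma ucomp_iso_oracle_query L : ucomp2 (iso_oracle_query L).
Proof.
have dP := ucomp_diagram_query L.
exact: ucomp_join_query (ucomp_join_query dP ucomp_graph_query) dP.
Qed.

(** * Functors *)

Lemma computes_setE Q X Y : computes_set Q X Y -> [set n | eval X Q [tuple n] 1] = Y.
Proof.
move=> QP; apply/seteqP; split=> n /=; last by case: (QP n).
by move=> ev; apply: contrapT => /(QP n).2 /(eval_functional ev).
Qed.

(** The complements of the diagram and of the oracle for isomorphisms are
    enumerable from them. A function is replaced by its graph: it is decided
    before it can be enumerated, and searched when the function is computed. *)
Lemma enumerable_iff_computable (L1 L2 : language) (C : class L1) (D : class L2)
    (F : functor C D) : enumerable_functor F <-> computable_functor F.
Proof.
split=> -[P [Ps [PE PsE]]].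
  have [Phi PhiP] := decision_of_enum P (ucomp_diagram_query L2).
  have [Phis PhisP] := function_of_enum Ps.
  exists Phi, Phis; split=> [A|A B f]; last exact/PhisP/PsE.
  exact: PhiP (diagram_co_query _) (PE A).
have [Q QP] := graph_decision Ps.
have [Psi PsiP] := enum_of_computation P (ucomp_diagram_query L1).
have [Psis PsisP] := enum_of_computation Q (ucomp_iso_oracle_query L1).
exists Psi, Psis; split=> [A|A B f].
  by rewrite PsiP; [apply: computes_setE | apply: diagram_co_query].
by rewrite PsisP; [apply/computes_setE/QP/PsE | apply: iso_oracle_co_query].
Qed.

Theorem corollary27 (L1 L2 : language) (C : class L1) (D : class L2) :
  uet_reducible C D <-> uct_reducible C D.
Proof.
by split=> -[D' [D'D [F [G [FP GP FG]]]]]; exists D'; split=> //; exists F, G;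
  split=> //; apply/enumerable_iff_computable.
Qed.
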